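(* Let $w=\sigma_{k_1}^{\epsilon_1}\sigma_{k_2}^{\epsilon_2}\cdots\sigma_{k_n}^{\epsilon_n}$ be a word in the braid group $\mathbb{B}_6$, with non-zero integers $\epsilon_i$ and $k_i\in\{1,2,3,4,5\}$ for $1\le i\le n$, and suppose that $q_6(w)$ is a plat presentation for a rational 3-tangle $T$. Let $B=B_{k_1}^{\epsilon_1}B_{k_2}^{\epsilon_2}\cdots B_{k_n}^{\epsilon_n}$, where $B_1,\dots,B_5$ are the $5\times5$ matrices given in the context. Then $$\langle T\rangle=f^T_1(a)\langle 0_1\rangle+f^T_2(a)\langle 0_2\rangle+f^T_3(a)\langle 0_3\rangle+f^T_4(a)\langle 0_4\rangle+f^T_5(a)\langle 0_5\rangle,$$ where $$[f^T_1(a)\; f^T_2(a)\; f^T_3(a)\; f^T_4(a)\; f^T_5(a)]^t=B\,[0\;0\;1\;0\;0]^t$$ (i.e. the third column of $B$). Also, if $K$ is the knot represented by the plat presentation $\overline{q_6(w)}$ and $k=-a^2-a^{-2}$, then $$\langle K\rangle=f^T_1(a)+k\bigl(f^T_2(a)+f^T_4(a)+f^T_5(a)\bigr)+k^2f^T_3(a),$$ and therefore $$X_K(a)=(-a^{-3})^{w(\overrightarrow{K})}\Bigl(f^T_1(a)+k\bigl(f^T_2(a)+f^T_4(a)+f^T_5(a)\bigr)+k^2f^T_3(a)\Bigr),$$ where $w(\overrightarrow{K})$ is the writhe of $K$ (computed in the diagram $\overline{q_6(w)}$).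
   Context: Braids and plats. A word in $\mathbb{B}_{6}$ is drawn as a braid diagram on 6 vertical strings, read from top to bottom (the first letter is topmost). The top endpoints lie on the $x$-axis and are numbered $1,\dots,6$ from left to right. $\sigma_i$ is a crossing between the strings in positions $i,i+1$ whose overcrossing strand runs from bottom-left to top-right; $\sigma_i^{-1}$ is the opposite crossing. $q_{6}(w)$ is the 3-tangle diagram in the lower half plane (with endpoints $1,\dots,6$) obtained from the braid $w$ by joining the bottom endpoints in positions $(1,2),(3,4),(5,6)$ by trivial arcs. Its plat closure $\overline{q_6(w)}=p_6(w)$ is obtained by also joining the top endpoints $1$–$2$, $3$–$4$, $5$–$6$ by trivial arcs in the upper half plane. A rational 3-tangle is a triple of disjoint properly embedded arcs in a 3-ball simultaneously isotopic, rel endpoints, into the boundary. Trivial 3-tangles (crossingless, in the lower half plane), given by the pairs of endpoints joined: $0_1:\{23,45,16\}$; $0_2:\{14,23,56\}$; $0_3:\{12,34,56\}$; $0_4:\{16,25,34\}$; $0_5:\{12,36,45\}$. Kauffman bracket, with values in $\Lambda=\mathbb{Z}[a,a^{-1}]$: $\langle\text{unknot circle}\rangle=1$; $\langle L\sqcup\bigcirc\rangle=k\langle L\rangle$ with $k=-a^2-a^{-2}$, where $\bigcirc$ is a crossingless circle disjoint from the rest of the diagram; and for a crossing $\langle\sigma_i^{\pm1}\rangle=a^{\pm1}\langle\mathrm{id}\rangle+a^{\mp1}\langle U_i\rangle$, where $\mathrm{id}$ replaces the crossing by two vertical strings and $U_i$ replaces it by a cup above a cap (joining the two upper ends to each other and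 the two lower ends to each other), the rest of the diagram being fixed. For a 3-tangle diagram $T$, $\langle T\rangle=\sum_{i=1}^5 f_i^T(a)\langle 0_i\rangle$ is the formal $\Lambda$-linear combination obtained by applying these rules until only the trivial tangles $0_1,\dots,0_5$ remain. For a knot $K$ given by a diagram, $\langle K\rangle$ is the bracket of that diagram and $X_K(a)=(-a^{-3})^{w(\overrightarrow K)}\langle K\rangle$ is the Kauffman polynomial; the writhe $w(\overrightarrow K)$ is the sum of the crossing signs ($+1$ right-handed, $-1$ left-handed) after orienting $K$. Matrices: $$B_1^{\pm1}=\begin{bmatrix}a^{\pm1}&0&0&0&0\\ 0&a^{\pm1}&0&0&0\\ 0&a^{\mp1}&-a^{\mp3}&a^{\mp1}&0\\ 0&0&0&a^{\pm1}&0\\ a^{\mp1}&0&0&0&-a^{\mp3}\end{bmatrix},\quad B_2^{\pm1}=\begin{bmatrix}-a^{\mp3}&0&0&a^{\mp1}&a^{\mp1}\\ 0&-a^{\mp3}&a^{\mp1}&0&0\\ 0&0&a^{\pm1}&0&0\\ 0&0&0&a^{\pm1}&0\\ 0&0&0&0&a^{\pm1}\end{bmatrix},$$ $$B_3^{\pm1}=\begin{bmatrix}a^{\pm1}&0&0&0&0\\ 0&a^{\pm1}&0&0&0\\ 0&a^{\mp1}&-a^{\mp3}&0&a^{\mp1}\\ a^{\mp1}&0&0&-a^{\mp3}&0\\ 0&0&0&0&a^{\pm1}\end{bmatrix},\quad B_4^{\pm1}=\begin{bmatrix}-a^{\mp3}&a^{\mp1}&0&a^{\mp1}&0\\ 0&a^{\pm1}&0&0&0\\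 0&0&a^{\pm1}&0&0\\ 0&0&0&a^{\pm1}&0\\ 0&0&a^{\mp1}&0&-a^{\mp3}\end{bmatrix},$$ $$B_5^{\pm1}=\begin{bmatrix}a^{\pm1}&0&0&0&0\\ a^{\mp1}&-a^{\mp3}&0&0&0\\ 0&0&-a^{\mp3}&a^{\mp1}&a^{\mp1}\\ 0&0&0&a^{\pm1}&0\\ 0&0&0&0&a^{\pm1}\end{bmatrix}.$$ *)

(* Defs.v *)
From HB Require Import structures.
From mathcomp Require Import all_boot all_order all_fingroup all_algebra.
From mathcomp Require Import boolp.

Set Implicit Arguments.
Unset Strict Implicit.
Unset Printing Implicit Defensive.

Import GRing.Theory Num.Theory.
Local Open Scope ring_scope.

                                                                                
                                                                                

Definition is_laurent : pred {fraction {poly int}} :=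
  fun x => `[< exists (p : {poly int}) (n : nat), x = tofrac p / tofrac 'X^n >].

Lemma fracX_neq0 n : tofrac ('X^n : {poly int}) != 0.
Proof. by rewrite tofrac_eq0 monic_neq0 ?monicXn. Qed.

Fact is_laurent_subring : subring_closed is_laurent.
Proof.
split.
- by apply/asboolP; exists 1, 0; rewrite expr0 tofrac1 divr1.
- move=> _ _ /asboolP[p [m ->]] /asboolP[q [n ->]]; apply/asboolP.
  exists (p * 'X^n - q * 'X^m), (m + n)%N.
  rewrite -mulNr addf_div ?fracX_neq0 // mulNr.
  by rewrite exprD tofracB !tofracM.
- move=> _ _ /asboolP[p [m ->]] /asboolP[q [n ->]]; apply/asboolP.
  by exists (p * q), (m + n)%N; rewrite mulf_div exprD !tofracM.
Qed.

HB.instance Definition _ :=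
  GRing.isSubringClosed.Build {fraction {poly int}} is_laurent
    is_laurent_subring.

Record laurent := Laurent {
  laurent_val :> {fraction {poly int}};
  laurent_valP : laurent_val \in is_laurent }.

HB.instance Definition _ := [isSub for laurent_val].
HB.instance Definition _ := [Choice of laurent by <:].
HB.instance Definition _ := [SubChoice_isSubComNzRing of laurent by <:].

Fact laurent_val0 : laurent_val 0 = 0. Proof. by []. Qed.
Fact laurent_val1 : laurent_val 1 = 1. Proof. by []. Qed.
Fact laurent_valM x y : laurent_val (x * y) = laurent_val x * laurent_val y.
Proof. by []. Qed.

Definition laurent_unit : pred laurent :=
  fun x => (x != 0) && ((val x)^-1 \in is_laurent).
Definition laurent_inv (x : laurent) : laurent := insubd x (val x)^-1.

Fact laurent_mulVx : {in laurent_unit, left_inverse 1 laurent_inv *%R}.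
Proof.
move=> x /andP[x0 xV]; apply: val_inj.
rewrite [LHS]laurent_valM [RHS]laurent_val1.
have -> : laurent_val (laurent_inv x) = (laurent_val x)^-1.
  by rewrite /laurent_inv [LHS]val_insubd xV.
apply: mulVf; apply: contraNneq x0 => x0.
by apply/eqP; apply: val_inj; rewrite [LHS]x0 [RHS]laurent_val0.
Qed.

Fact laurent_intro_unit (x y : laurent) : y * x = 1 -> laurent_unit x.
Proof.
move=> /(congr1 laurent_val); rewrite laurent_valM laurent_val1 => yx.
have x0 : laurent_val x != 0.
  by apply: contra_eq_neq yx => ->; rewrite mulr0 eq_sym oner_neq0.
apply/andP; split.
  by apply: contraNneq x0 => ->; rewrite laurent_val0.
suff -> : (val x)^-1 = laurent_val y by exact: laurent_valP.
by rewrite -[RHS](mulfK x0) yx mul1r.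
Qed.

Fact laurent_inv_out : {in [predC laurent_unit], laurent_inv =1 id}.
Proof.
move=> x xU; apply: val_inj; rewrite /laurent_inv [LHS]val_insubd.
case: ifP => // xV; move: xU.
rewrite inE /= negb_and xV orbF negbK => /eqP->.
by rewrite [val _]laurent_val0 invr0.
Qed.

HB.instance Definition _ := GRing.ComNzRing_hasMulInverse.Build laurent
  laurent_mulVx laurent_intro_unit laurent_inv_out.

Fact frac_X_laurent : tofrac 'X \in is_laurent.
Proof. by apply/asboolP; exists 'X, 0; rewrite expr0 tofrac1 divr1. Qed.

Definition a : laurent := Laurent frac_X_laurent.

Fact a_unit : a \is a GRing.unit.
Proof.
apply/andP; split.
  apply/eqP => /(congr1 laurent_val)/eqP; rewrite laurent_val0 /=.
  by rewrite -['X]expr1 (negPf (fracX_neq0 1)).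
by apply/asboolP; exists 1, 1; rewrite expr1 tofrac1 div1r.
Qed.

Definition k : laurent := - a ^ 2 - a ^ (-2).

                                                                                
                                                                                
                                                                                
                                                                                
                                                                                

Record crossing (V : Type) := Crossing { pos : bool; tl : V; tr : V; bl : V; br : V }.

Definition map_crossing (V W : Type) (h : V -> W) (c : crossing V) :=
  Crossing (pos c) (h (tl c)) (h (tr c)) (h (bl c)) (h (br c)).

Record diagram (m : nat) := Diagram {
  point : finType;
  endpt : 'I_m -> point;
  crossings : seq (crossing point);
  arcs : seq (point * point) }.

Definition adjacent (V : finType) (es : seq (V * V)) : rel V :=
  fun x y => ((x, y) \in es) || ((y, x) \in es).

Definition joined (V : finType) (es : seq (V * V)) : rel V :=
  connect (adjacent es).

                                                                                
                                                                                
                                                                                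

Definition left_pos (i : 'I_5) : 'I_6 := widen_ord (leqnSn 5) i.
Definition right_pos (i : 'I_5) : 'I_6 := lift ord0 i.

                                                                        
Definition stack (i : 'I_5) (s : bool) (D : diagram 6) : diagram 6 :=
  let top (j : 'I_6) : 'I_6 + point D := inl j in
  let bot (j : 'I_6) : 'I_6 + point D := inr (endpt D j) in
  let l := left_pos i in
  let r := right_pos i in
  Diagram top
    (Crossing s (top l) (top r) (bot l) (bot r)
       :: [seq map_crossing inr c | c <- crossings D])
    ([seq (top j, bot j) | j <- enum 'I_6 & (j != l) && (j != r)]
       ++ [seq (inr e.1, inr e.2) | e <- arcs D]).

                                                                                
                                                                                
Definition trivial_pairs (i : 'I_5) : seq (nat * nat) :=
  nth [::] [:: [:: (2, 3); (4, 5); (1, 6)];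
               [:: (1, 4); (2, 3); (5, 6)];
               [:: (1, 2); (3, 4); (5, 6)];
               [:: (1, 6); (2, 5); (3, 4)];
               [:: (1, 2); (3, 6); (4, 5)]]%N i.

Definition plat_arcs (V : Type) (e : 'I_6 -> V) : seq (V * V) :=
  [seq (e (inord p.1), e (inord p.2)) | p <- [:: (0, 1); (2, 3); (4, 5)]%N].

Definition plat_bottom : diagram 6 := Diagram id [::] (plat_arcs id).

Definition braid_word := seq ('I_5 * int).

Definition q6 (w : braid_word) : diagram 6 :=
  foldr (fun l D => iter `|l.2|%N (stack l.1 (0 < l.2)) D) plat_bottom w.

Definition plat_closure (D : diagram 6) : diagram 0 :=
  @Diagram 0 (point D) (fun i => match notF (valP i) with end)
    (crossings D) (plat_arcs (endpt D) ++ arcs D).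

                                                                                
                                                                                

Definition smooth_id V (c : crossing V) := [:: (tl c, bl c); (tr c, br c)].
Definition smooth_U V (c : crossing V) := [:: (tl c, tr c); (bl c, br c)].

Fixpoint resolve (M : lmodType laurent) (V : Type) (ev : seq (V * V) -> M)
    (cs : seq (crossing V)) (es : seq (V * V)) : M :=
  if cs is c :: cs' then
    let s : int := if pos c then 1 else -1 in
    a ^ s *: resolve ev cs' (smooth_id c ++ es)
      + a ^ (- s) *: resolve ev cs' (smooth_U c ++ es)
  else ev es.

                                                                     
Definition circles (m : nat) (V : finType) (e : 'I_m -> V) (es : seq (V * V)) : nat :=
  n_comp (adjacent es) [pred x | [forall i, ~~ joined es (e i) x]].

Definition joins_as (i : 'I_5) (V : finType) (e : 'I_6 -> V) (es : seq (V * V)) : bool :=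
  [forall x : 'I_6, forall y : 'I_6, joined es (e x) (e y) ==
    [|| x == y, (x.+1, y.+1) \in trivial_pairs i
              | (y.+1, x.+1) \in trivial_pairs i]].

                                                                                
                                                                                
Definition bracket0 (i : 'I_5) : 'cV[laurent]_5 := delta_mx i 0.

                                                                                
                                                                                
Definition tangle_bracket (T : diagram 6) : 'cV[laurent]_5 :=
  resolve (fun es => \sum_(i < 5 | joins_as i (endpt T) es)
                        k ^+ circles (endpt T) es *: bracket0 i)
    (crossings T) (arcs T).

Definition link_bracket (L : diagram 0) : laurent :=
  resolve (M := laurent^o) (fun es => k ^+ (circles (endpt L) es).-1)
    (crossings L) (arcs L).

                                                                                

Definition over_strand V (c : crossing V) :=
  if pos c then (bl c, tr c) else (br c, tl c).
Definition under_strand V (c : crossing V) :=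
  if pos c then (br c, tl c) else (bl c, tr c).

Definition strands m (D : diagram m) : seq (point D * point D) :=
  [seq over_strand c | c <- crossings D]
    ++ [seq under_strand c | c <- crossings D] ++ arcs D.

Definition is_knot (L : diagram 0) : bool :=
  n_comp (adjacent (strands L)) predT == 1%N.

                                                                                
                                                                                
                                                                                
Record orientation := Orientation {
  or_over : seq bool; or_under : seq bool; or_arcs : seq bool }.

Definition directed V (b : bool) (e : V * V) : V * V :=
  if b then e else (e.2, e.1).

Definition directed_strands (L : diagram 0) (o : orientation) :=
  [seq directed be.1 be.2
     | be <- zip (or_over o ++ or_under o ++ or_arcs o) (strands L)].

                                                                                
                                                                                
Definition is_orientation (L : diagram 0) (o : orientation) : bool :=
  [&& size (or_over o) == size (crossings L),
      size (or_under o) == size (crossings L),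
      size (or_arcs o) == size (arcs L),
      perm_eq (unzip1 (directed_strands L o)) (enum (point L))
    & perm_eq (unzip2 (directed_strands L o)) (enum (point L))].

                                                                                
                                                                                
Definition crossing_sign V (c : crossing V) (over under : bool) : int :=
  if pos c == (over == under) then 1 else -1.

Definition writhe (L : diagram 0) (o : orientation) : int :=
  \sum_(t <- zip (crossings L) (zip (or_over o) (or_under o)))
     crossing_sign t.1 t.2.1 t.2.2.

Definition kauffman_poly (L : diagram 0) (o : orientation) : laurent :=
  (- a ^ (-3)) ^ writhe L o * link_bracket L.

                                             

Definition mx_of_rows (rows : seq (seq laurent)) : 'M[laurent]_5 :=
  \matrix_(i, j) nth 0 (nth [::] rows i) j.

Definition Bgen (i : 'I_5) (s : int) : 'M[laurent]_5 :=
  let p := a ^ s in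
  let n := a ^ (- s) in
  let d := - a ^ (- (3 * s)) in
  nth 0
   [:: mx_of_rows
        [:: [:: p; 0; 0; 0; 0];
            [:: 0; p; 0; 0; 0];
            [:: 0; n; d; n; 0];
            [:: 0; 0; 0; p; 0];
            [:: n; 0; 0; 0; d]];
       mx_of_rows
        [:: [:: d; 0; 0; n; n];
            [:: 0; d; n; 0; 0];
            [:: 0; 0; p; 0; 0];
            [:: 0; 0; 0; p; 0];
            [:: 0; 0; 0; 0; p]];
       mx_of_rows
        [:: [:: p; 0; 0; 0; 0];
            [:: 0; p; 0; 0; 0];
            [:: 0; n; d; 0; n];
            [:: n; 0; 0; d; 0];
            [:: 0; 0; 0; 0; p]];
       mx_of_rows
        [:: [:: d; n; 0; n; 0];
            [:: 0; p; 0; 0; 0];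
            [:: 0; 0; p; 0; 0];
            [:: 0; 0; 0; p; 0];
            [:: 0; 0; n; 0; d]];
       mx_of_rows
        [:: [:: p; 0; 0; 0; 0];
            [:: n; d; 0; 0; 0];
            [:: 0; 0; d; n; n];
            [:: 0; 0; 0; p; 0];
            [:: 0; 0; 0; 0; p]]] i.

Definition Bpow (i : 'I_5) (e : int) : 'M[laurent]_5 := Bgen i (sgz e) ^+ `|e|%N.

Definition Bword (w : braid_word) : 'M[laurent]_5 :=
  \prod_(l <- w) Bpow l.1 l.2.

Definition e3 : 'cV[laurent]_5 := \col_i (i == 2 :> nat)%:R.

(* Main.v *)
Require Import Defs.
From mathcomp Require Import all_boot all_order all_fingroup all_algebra.
From mathcomp Require Import ring.

Set Implicit Arguments.
Unset Strict Implicit.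
Unset Printing Implicit Defensive.

Import GRing.Theory Num.Theory.
Local Open Scope ring_scope.

(** Expanding all the crossings of a tangle diagram writes its bracket as a sum
    over states, a state being a crossingless diagram.  A state is recorded by
    a graph whose edges are its arcs: the only data that matter are which
    endpoints lie in the same component, and how many components avoid the
    endpoints.  For the diagrams [q6 w] every state joins the endpoints as one
    of the five trivial tangles, so it has the value k^c <0_j>.

    Stacking one crossing on top of a diagram either prolongs the six strings,
    which changes nothing in a state, or glues the hook U_i on top of it.  The
    latter turns 0_j into another trivial tangle U_i 0_j, with one more circle
    exactly when 0_j already joins i to i+1, that is when U_i 0_j = 0_j up to
    that circle.  Hence the bracket is multiplied by a^s + a^-s U_i, where U_i
    stands for the matrix [TLgen i] of this action (a Temperley-Lieb
    generator), and this is the matrix B_i^s of the theorem because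
    a^s + a^-s k = - a^-3s for s = 1 or -1 ([BgenE]).  Induction on the word
    ([tangle_bracket_stack], [tangle_bracket_q6]) starts from the plat bottom,
    which is 0_3.  The plat closure is treated in the same way: it adds
    between one and three circles to a state, according to its 0_j
    ([link_bracket_closure]).

    The topology is thus reduced to the effect of new edges between endpoints
    on the components of a graph.  Adding an edge merges two components or
    none, so the components of the endpoints can be followed by relabelling
    these endpoints with natural numbers, whatever the rest of the graph is
    ([labels_relabel], [n_comp_merges]).  The statements about U_i 0_j and
    about closures then become computations over finitely many labels. *)

(** * Components of a graph given by a list of edges *)

Lemma adjacent_sym (V : finType) (es : seq (V * V)) : symmetric (adjacent es).
Proof. by move=> x y; rewrite /adjacent orbC. Qed.

Lemma joined_sym (V : finType) (es : seq (V * V)) : connect_sym (adjacent es).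
Proof. exact: sym_connect_sym (adjacent_sym es). Qed.

Lemma joinedC (V : finType) (es : seq (V * V)) : symmetric (joined es).
Proof. exact: joined_sym. Qed.

Lemma eq_adjacent (V : finType) (es es' : seq (V * V)) :
  es =i es' -> adjacent es =2 adjacent es'.
Proof. by move=> eq_es x y; rewrite /adjacent !eq_es. Qed.

Lemma eq_joined (V : finType) (es es' : seq (V * V)) :
  es =i es' -> joined es =2 joined es'.
Proof. by move/eq_adjacent/eq_connect. Qed.

Lemma eq_n_comp_adjacent (V : finType) (es es' : seq (V * V)) :
  es =i es' -> n_comp (adjacent es) V = n_comp (adjacent es') V.
Proof. by move=> eq_es; apply: (eq_n_comp (eq_joined eq_es)). Qed.

Lemma joined_nil (V : finType) (x y : V) : joined [::] x y = (x == y).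
Proof.
by apply/idP/eqP => [/connectP[[|z p] //= _ ->]|->] //; exact: connect0.
Qed.

Lemma n_comp_nil (V : finType) :
  n_comp (adjacent ([::] : seq (V * V))) V = #|V|.
Proof.
rewrite [LHS]/n_comp_mem; apply: eq_card => x.
by rewrite !inE andbT /roots eq_sym -joined_nil; exact: connect_root.
Qed.

Lemma joined_cons (V : finType) (es : seq (V * V)) (u v x y : V) :
  joined ((u, v) :: es) x y =
    [|| joined es x y, joined es x u && joined es v y
      | joined es x v && joined es u y].
Proof.
have sub z t : joined es z t -> joined ((u, v) :: es) z t.
  apply: connect_sub => {}z {}t zt; apply: connect1.
  by move: zt; rewrite /adjacent !inE => /orP[]->; rewrite !orbT.
have uv : joined ((u, v) :: es) u v.
  by apply: connect1; rewrite /adjacent inE eqxx.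
have vu : joined ((u, v) :: es) v u by rewrite joinedC.
have tr : transitive (joined es) := @connect_trans V (adjacent es).
apply/idP/idP=> [xy|]; last first.
  case/or3P=> [/sub//|/andP[/sub xu /sub vy]|/andP[/sub xv /sub uy]].
    exact: connect_trans xu (connect_trans uv vy).
  exact: connect_trans xv (connect_trans vu uy).
(* The right-hand side, as a predicate of [y], holds at [x] and is stable under
   adjacency in the larger graph. *)
pose R : pred V := fun y => [|| joined es x y, joined es x u && joined es v y
      | joined es x v && joined es u y].
have clR : closed (adjacent ((u, v) :: es)) R.
  apply: (intro_closed (joined_sym _)) => z t zt; rewrite !unfold_in => Rz.
  have [zt'|/negP nzt] := boolP (adjacent es z t).
    move/connect1: zt' => zt'.
    by case/or3P: Rz => [xz|/andP[-> vz]|/andP[-> uz]];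
      [rewrite (tr _ _ _ xz zt')|rewrite (tr _ _ _ vz zt') orbT
      |rewrite (tr _ _ _ uz zt') !orbT].
  have : ((z, t) == (u, v)) || ((t, z) == (u, v)).
    move: zt nzt; rewrite /adjacent !inE.
    by do 2!case: eqP => //=; do 2!case: (_ \in es).
  have c0 z' : joined es z' z' by exact: connect0.
  case/orP=> /eqP[? ?]; subst z t; case/or3P: Rz => [-> | /andP[] | /andP[]];
    rewrite ?c0 ?andbT ?orbT // => ->; rewrite ?orbT //.
have := closed_connect clR xy; rewrite !unfold_in => <-.
by rewrite [joined es x x]connect0.
Qed.

Lemma mem_closure2 (V : finType) (es : seq (V * V)) (u v x : V) :
  (x \in closure (adjacent es) (pred2 u v)) = joined es x u || joined es x v.
Proof.
apply/pred0Pn/orP => [[y /andP[xy]]|].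
  by rewrite !inE => /orP[]/eqP<-; [left|right].
by case=> xy; [exists u|exists v]; rewrite /= !inE eqxx ?orbT andbT.
Qed.

(** Outside the components of [u] and [v] both graphs are the same; inside, the
    larger graph has one component, and the smaller one has one or two. *)
Lemma n_comp_cons (V : finType) (es : seq (V * V)) (u v : V) :
  (n_comp (adjacent ((u, v) :: es)) V + ~~ joined es u v)%N
    = n_comp (adjacent es) V.
Proof.
set e' := adjacent ((u, v) :: es); set e := adjacent es.
pose A := closure e (pred2 u v).
have AE : A =i closure e' (pred2 u v).
  move=> x; rewrite !mem_closure2 !joined_cons ![joined es u u]connect0.
  rewrite ![joined es v v]connect0 (joinedC es v u).
  by case: (joined es x u) (joined es x v) (joined es u v) => [] [] [].
have symV (es1 : seq (V * V)) := @joined_sym V es1.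
have clA : closed e A by exact: closure_closed (symV es) _.
have clA' : closed e' A.
  move=> x y xy; rewrite !AE.
  exact: (closure_closed (symV _) (pred2 u v) xy).
rewrite (n_compC A) [RHS](n_compC A).
have -> : n_comp e A = (~~ joined es u v).+1.
  exact: n_comp_closure2 (symV es) u v.
have -> : n_comp e' A = 1%N.
  rewrite (eq_n_comp_r AE) (n_comp_closure2 (symV _)).
  suff -> : connect e' u v by [].
  by apply: connect1; rewrite /e' /adjacent inE eqxx.
suff -> : n_comp e' [predC A] = n_comp e [predC A].
  by rewrite addnAC add1n addSn.
apply: (adjunction_n_comp id (symV _) (symV _) (predC_closed clA')).
split=> [x _|x y]; first by exists x.
rewrite inE /= mem_closure2 negb_or => /andP[/negPf xu /negPf xv].
by rewrite -[connect e' x y]/(joined _ _ _) joined_cons xu xv orbF.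
Qed.

(** The points [m x] are the marked points of a graph that is otherwise unknown;
    new edges are only added between them. *)
Section Labels.

Variables (I : Type) (V : finType) (m : I -> V).

Definition map_edges (E : seq (I * I)) : seq (V * V) :=
  [seq (m p.1, m p.2) | p <- E].

(** One union-find step for each edge.  The local definitions let the
    evaluation compute the labels of both ends of an edge only once. *)
Fixpoint relabel (E : seq (I * I)) (L : I -> nat) : I -> nat :=
  if E is p :: E' then
    let L' := relabel E' L in
    let cu := L' p.1 in
    let cv := L' p.2 in
    fun x => let c := L' x in if c == cu then cv else c
  else L.

(** The number of edges that join two different components at the time when
    they are added, the last edge of the list being added first. *)
Fixpoint merges (E : seq (I * I)) (L : I -> nat) : nat :=
  if E is p :: E' then
    ((relabel E' L p.1 != relabel E' L p.2) + merges E' L)%N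
  else 0.

Definition labels (es : seq (V * V)) (L : I -> nat) :=
  forall x y, joined es (m x) (m y) = (L x == L y).

(** The labels of the marked points determine by themselves the labels after
    the addition of edges: this is what makes the components computable. *)
Lemma labels_relabel es L E :
  labels es L -> labels (map_edges E ++ es) (relabel E L).
Proof.
move=> esL; elim: E => //= p E IH x y; rewrite joined_cons !IH.
move: (relabel E L) => c; rewrite [c p.1 == c y]eq_sym.
have [->|/negPf xu] := eqVneq (c x) (c p.1);
  have [->|_] := eqVneq (c y) (c p.1);
  by rewrite ?eqxx ?xu ?andbF ?andbT ?orbF.
Qed.

Lemma n_comp_merges es L E : labels es L ->
  (n_comp (adjacent (map_edges E ++ es)) V + merges E L)%N
    = n_comp (adjacent es) V.
Proof.
move=> esL; elim: E => [|p E IH] /=; first by rewrite addn0.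
by rewrite addnA -(labels_relabel E esL) n_comp_cons.
Qed.

End Labels.

(** * Adding isolated points *)

Lemma joined_inr (T V : finType) (es : seq (V * V)) (x y : V) :
  joined (map_edges (@inr T V) es) (inr x) (inr y) = joined es x y.
Proof.
elim: es x y => [|p es IH] x y; first by rewrite !joined_nil.
by case: p => u v; rewrite /= !joined_cons !IH.
Qed.

Lemma joined_inl (T V : finType) (es : seq (V * V)) (x : T) (y : T + V) :
  joined (map_edges (@inr T V) es) (inl x) y = (inl x == y).
Proof.
elim: es y => [|p es IH] y; first by rewrite joined_nil.
by case: p => u v; rewrite /= joined_cons !IH orbF.
Qed.

Lemma n_comp_inr (T V : finType) (es : seq (V * V)) :
  n_comp (adjacent (map_edges (@inr T V) es)) {: T + V}
    = (#|T| + n_comp (adjacent es) V)%N.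
Proof.
elim: es => [|p es IH]; first by rewrite !n_comp_nil card_sum.
apply: (@addIn (~~ joined es p.1 p.2)); case: p => u v.
by rewrite -addnA n_comp_cons -IH -(joined_inr T) n_comp_cons.
Qed.

(** * Trivial tangles *)

(** An enumeration of ['I_n] that reduces to explicit ordinals, on which
    [all] can be evaluated. *)
Fixpoint ords n : seq 'I_n :=
  if n is n'.+1 then ord0 :: [seq lift ord0 j | j <- ords n'] else [::].

Lemma ordsE n : ords n = enum 'I_n.
Proof.
elim: n => [|n IH] /=; last by rewrite enum_ordSl IH.
by apply/esym/size0nil; rewrite size_enum_ord.
Qed.

Lemma all_ords n (P : pred 'I_n) : all P (ords n) -> forall i, P i.
Proof. by move=> /allP P_ i; apply: P_; rewrite ordsE mem_enum. Qed.

Definition pairing (j : 'I_5) (x y : 'I_6) : bool :=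
  [|| x == y, (x.+1, y.+1) \in trivial_pairs j
     | (y.+1, x.+1) \in trivial_pairs j].

Definition trivial_edges (j : 'I_5) : seq ('I_6 * 'I_6) :=
  [seq p : 'I_6 * 'I_6 <- [seq (x, y) | x <- ords 6, y <- ords 6]
     | (p.1.+1, p.2.+1) \in trivial_pairs j].

Definition trivial_label (j : 'I_5) : 'I_6 -> nat :=
  relabel (trivial_edges j) (@nat_of_ord 6).

Lemma labels_nil :
  labels id ([::] : seq ('I_6 * 'I_6)) (@nat_of_ord 6).
Proof. by move=> x y; rewrite joined_nil. Qed.

(** The six endpoints of a trivial tangle form three components. *)
Lemma trivial_merges j : merges (trivial_edges j) (@nat_of_ord 6) = 3.
Proof. by apply/eqP; move: j; apply: all_ords; vm_compute. Qed.

Lemma pairingE j x y : pairing j x y = (trivial_label j x == trivial_label j y).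
Proof.
apply/eqP; move: y; apply: all_ords; move: x; apply: all_ords.
by move: j; apply: all_ords; vm_compute.
Qed.

Lemma joins_asP j (V : finType) (e : 'I_6 -> V) es :
  reflect (labels e es (trivial_label j)) (joins_as j e es).
Proof.
apply: (iffP forallP) => [J x y|J x].
  by have /forallP/(_ y)/eqP-> := J x; rewrite -pairingE.
by apply/forallP=> y; rewrite J -pairingE.
Qed.

Lemma pairing_inj j j' : pairing j =2 pairing j' -> j = j'.
Proof.
move=> jj'; apply/eqP; move: jj'.
suff: all (fun x => all (fun y => pairing j x y == pairing j' x y) (ords 6))
        (ords 6) ==> (j == j').
  by move=> /implyP jj' E; apply: jj'; apply/allP=> x _; apply/allP=> y _;
     rewrite E.
by move: j'; apply: all_ords; move: j; apply: all_ords; vm_compute.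
Qed.

Lemma joins_as_uniq j j' (V : finType) (e : 'I_6 -> V) es :
  joins_as j e es -> joins_as j' e es = (j' == j).
Proof.
move=> /joins_asP J; apply/joins_asP/eqP => [J'|->//].
by apply: pairing_inj => x y; rewrite !pairingE -J -J'.
Qed.

(** Among all components, three contain endpoints.  Counting all of them is
    more convenient than counting circles, since it does not depend on the
    endpoints. *)
Lemma circlesE j (V : finType) (e : 'I_6 -> V) es : joins_as j e es ->
  (circles e es + 3)%N = n_comp (adjacent es) V.
Proof.
move/joins_asP=> J.
rewrite [RHS](n_compC [pred x | [forall i, ~~ joined es (e i) x]]).
congr addn; set A := [predC _].
have clA : closed (adjacent es) A.
  apply: predC_closed; apply: (intro_closed (joined_sym _)) => x y xy.
  rewrite !inE => /forallP H; apply/forallP=> i; apply: contra (H i) => iy.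
  by rewrite -[joined _ _ _](same_connect1r (joined_sym _) xy) in iy.
pose E := map_edges id (trivial_edges j) ++ [::].
have lab := labels_relabel (trivial_edges j) labels_nil.
(* The components that contain endpoints are counted on the six endpoints
   alone, with the arcs of the trivial tangle as edges. *)
rewrite (adjunction_n_comp e (joined_sym _) (joined_sym E) clA); last first.
  split=> [x|x y _].
    rewrite !inE negb_forall => /existsP/sigW[i]; rewrite negbK joinedC => xi.
    by exists i.
  by rewrite -/(joined _ _ _) lab -/(joined _ _ _) J.
rewrite (@eq_n_comp_r _ _ _ predT) => [|x]; last first.
  rewrite !inE negb_forall; apply/existsP; exists x.
  by rewrite negbK [joined _ _ _]connect0.
have := n_comp_merges (trivial_edges j) labels_nil; rewrite n_comp_nil card_ord.
rewrite trivial_merges.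
by move=> EE; apply: (@addIn 3); rewrite [RHS]EE.
Qed.

(** * States of a diagram *)

Section States.

Variable V : Type.

Fixpoint states (cs : seq (crossing V)) (es : seq (V * V)) :
    seq (seq (V * V)) :=
  if cs is c :: cs' then
    states cs' (smooth_id c ++ es) ++ states cs' (smooth_U c ++ es)
  else [:: es].

End States.

(** The diagrams of this section arise from a smaller one by renaming its points
    and adding arcs [X]; their states arise from its states in the same way.
    Arcs are compared as sets, because [resolve] puts the arcs of the smoothed
    crossings in front of [X]. *)
Section Transport.

Variables (V W : finType) (h : V -> W).

Lemma smooth_transport (X : seq (W * W)) (sm es : seq (V * V)) es' :
    es' =i X ++ map_edges h es ->
  map_edges h sm ++ es' =i X ++ map_edges h (sm ++ es).
Proof.
move=> eq_es p.
by rewrite /map_edges map_cat !mem_cat eq_es mem_cat orbCA.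
Qed.

Lemma states_transport (X : seq (W * W)) cs es es' s' :
    es' =i X ++ map_edges h es ->
    s' \in states [seq map_crossing h c | c <- cs] es' ->
  exists2 s, s \in states cs es & s' =i X ++ map_edges h s.
Proof.
elim: cs es es' => [|c cs IH] es es' eq_es /=.
  by rewrite inE => /eqP->; exists es; rewrite ?inE.
rewrite mem_cat => /orP[].
  case/(IH _ _ (smooth_transport (smooth_id c) eq_es)) => s ss ?.
  by exists s; rewrite // mem_cat ss.
case/(IH _ _ (smooth_transport (smooth_U c) eq_es)) => s ss ?.
by exists s; rewrite // mem_cat ss orbT.
Qed.

(** If new arcs act linearly on the value of each state, then they act in the
    same way on the whole bracket. *)
Lemma resolve_transport (M N : lmodType laurent) (ev : seq (V * V) -> M)
    (ev' : seq (W * W) -> N) (F : M -> N) (X : seq (W * W)) cs es es' :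
    (forall x y u v, F (x *: u + y *: v) = x *: F u + y *: F v) ->
    es' =i X ++ map_edges h es ->
    (forall s s', s \in states cs es -> s' =i X ++ map_edges h s ->
       ev' s' = F (ev s)) ->
  resolve ev' [seq map_crossing h c | c <- cs] es' = F (resolve ev cs es).
Proof.
move=> linF; elim: cs es es' => [|c cs IH] es es' eq_es evF /=.
  by apply: evF; rewrite ?inE.
rewrite linF; congr (_ *: _ + _ *: _).
  apply: (IH _ _ (smooth_transport (smooth_id c) eq_es)) => s s' ss.
  by apply: evF; rewrite mem_cat ss.
apply: (IH _ _ (smooth_transport (smooth_U c) eq_es)) => s s' ss.
by apply: evF; rewrite mem_cat ss orbT.
Qed.

End Transport.

(** * Stacking a crossing *)

(** The consequence of the planarity of a diagram on which the sum over states
    relies: a state whose endpoints were joined otherwise would contribute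
    nothing to [tangle_bracket]. *)
Definition planar (D : diagram 6) :=
  forall s, s \in states (crossings D) (arcs D) ->
    exists j, joins_as j (endpt D) s.

(** U_i 0_j is 0_(cup_cap i j), up to a circle. *)
Definition cup_cap (i j : 'I_5) : 'I_5 :=
  inZp (nth 0 (nth [::] [:: [:: 4; 2; 2; 2; 4]; [:: 0; 1; 1; 0; 0];
     [:: 3; 2; 2; 3; 2]; [:: 0; 0; 4; 0; 4]; [:: 1; 1; 2; 2; 2]] i) j)%N.

(** The arcs of a smoothed crossing and of the strings next to it.  Copies [inl]
    and [inr] of the six positions are its top and its bottom; the flag tells
    whether the crossing is smoothed to the hook. *)
Definition layer (i : 'I_5) (b : bool) : seq (('I_6 + 'I_6) * ('I_6 + 'I_6)) :=
  let l := left_pos i in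
  let r := right_pos i in
  (if b then [:: (inl l, inl r); (inr l, inr r)]
   else [:: (inl l, inr l); (inl r, inr r)])
  ++ [seq (inl j, inr j) | j <- ords 6 & (j != l) && (j != r)].

Definition mark (V : Type) (e : 'I_6 -> V) (x : 'I_6 + 'I_6) : 'I_6 + V :=
  match x with inl i => inl i | inr i => inr (e i) end.

(** Labels before the layer is glued: its top points are still isolated, hence
    the shift by 6 of the labels of the points below. *)
Definition layer_label (j : 'I_5) (x : 'I_6 + 'I_6) : nat :=
  match x with inl i => i | inr i => 6 + trivial_label j i end.

Lemma layer_joins (i j : 'I_5) (b : bool) (x y : 'I_6) :
  (relabel (layer i b) (layer_label j) (inl x)
     == relabel (layer i b) (layer_label j) (inl y))
  = (trivial_label (if b then cup_cap i j else j) x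
     == trivial_label (if b then cup_cap i j else j) y).
Proof.
apply: (elimT eqP); move: y; apply: all_ords; move: x; apply: all_ords.
by move: j; apply: all_ords; move: i; apply: all_ords; case: b; vm_compute.
Qed.

(** Of the six edges, each one merges two components, except that the lower arc
    of the hook closes a circle when 0_j already joins its ends. *)
Lemma layer_merges (i j : 'I_5) (b : bool) :
  (merges (layer i b) (layer_label j) + (b && (cup_cap i j == j)))%N = 6.
Proof.
apply/eqP; move: j; apply: all_ords; move: i; apply: all_ords.
by case: b; vm_compute.
Qed.

Lemma layer_state i j b (V : finType) (e : 'I_6 -> V) s s' :
    joins_as j e s ->
    s' =i map_edges (mark e) (layer i b) ++ map_edges inr s ->
  joins_as (if b then cup_cap i j else j) inl s' /\
  circles inl s' = (circles e s + (b && (cup_cap i j == j)))%N.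
Proof.
move=> J eq_s'.
have lab0 : labels (mark e) (map_edges inr s) (layer_label j).
  move/joins_asP: J => J [x|x] [y|y] /=.
  - by rewrite joined_inl.
  - rewrite joined_inl; apply/esym/negP => /eqP xy.
    by have := ltn_ord x; rewrite xy.
  - rewrite joinedC joined_inl; apply/esym/negP => /eqP xy.
    by have := ltn_ord y; rewrite -xy.
  - by rewrite joined_inr J eqn_add2l.
have J' : joins_as (if b then cup_cap i j else j) (@inl 'I_6 V) s'.
  apply/joins_asP => x y; rewrite (eq_joined eq_s').
  by rewrite (labels_relabel (layer i b) lab0 (inl x) (inl y)) layer_joins.
split=> //; apply: (@addIn 3); rewrite (circlesE J') addnAC (circlesE J).
apply: (@addIn (merges (layer i b) (layer_label j))).
rewrite (eq_n_comp_adjacent eq_s') (n_comp_merges _ lab0) n_comp_inr card_ord.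
by rewrite -addnA [(_ && _ + _)%N]addnC layer_merges addnC.
Qed.

(** The summand of a state in [tangle_bracket]. *)
Definition tangle_value (V : finType) (e : 'I_6 -> V) (es : seq (V * V)) :
    'cV[laurent]_5 :=
  \sum_(i < 5 | joins_as i e es) k ^+ circles e es *: bracket0 i.

Lemma tangle_valueE j (V : finType) (e : 'I_6 -> V) es :
  joins_as j e es -> tangle_value e es = k ^+ circles e es *: bracket0 j.
Proof.
by move=> J; apply: big_pred1 => j' /=; rewrite (joins_as_uniq _ J).
Qed.

Definition TLgen (i : 'I_5) : 'M[laurent]_5 :=
  \matrix_(r, j) (k ^+ (cup_cap i j == j) *+ (r == cup_cap i j)).

Definition crossing_sgn (s : bool) : int := if s then 1 else -1.

(** The factor contributed by a curl: it occurs on the diagonal of B_i, at the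
    trivial tangles which the hook maps to themselves and a circle. *)
Lemma Bgen_diag (s : bool) : let e := crossing_sgn s in
  - a ^ (- (3 * e)) = a ^ e + a ^ (- e) * k.
Proof.
rewrite /k mulrBr mulrN; case: s => /=.
  by rewrite -!(exprzDr a_unit) (_ : -1 + 2 = 1) // addrA subrr add0r.
by rewrite -!(exprzDr a_unit) (_ : - -1 - 2 = -1) // addrC -addrA addNr addr0.
Qed.

(** The skein relation at a single crossing, in the coordinates given by the
    trivial tangles. *)
Lemma BgenE i (s : bool) : let e := crossing_sgn s in
  Bgen i e = a ^ e *: 1%:M + a ^ (- e) *: TLgen i.
Proof.
move=> e; rewrite /Bgen Bgen_diag -/e; move: (a ^ e) (a ^ (- e)) => p n.
apply/matrixP => r c; rewrite 4!mxE.
case: i => [[|[|[|[|[|//]]]]] ?]; case: r => [[|[|[|[|[|//]]]]] ?];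
  case: c => [[|[|[|[|[|//]]]]] ?];
  by rewrite !mxE /= ?mulr1 ?mulr0 ?addr0 ?add0r.
Qed.

Lemma stack_arcs i b (V : finType) (e : 'I_6 -> V) (es : seq (V * V)) s :
  let l := left_pos i in
  let r := right_pos i in
  let c := Crossing s (inl l) (inl r) (inr (e l)) (inr (e r)) in
  (if b then smooth_U c else smooth_id c)
     ++ [seq (inl j, inr (e j)) | j <- enum 'I_6 & (j != l) && (j != r)]
     ++ [seq (inr p.1, inr p.2) | p <- es]
  = map_edges (mark e) (layer i b) ++ map_edges inr es.
Proof.
by case: b; rewrite /layer /map_edges map_cat -catA -map_comp ordsE.
Qed.

Lemma stack_states i s D s' :
    s' \in states (crossings (stack i s D)) (arcs (stack i s D)) ->
  exists (b : bool), exists2 s0, s0 \in states (crossings D) (arcs D) &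
    s' =i map_edges (mark (endpt D)) (layer i b) ++ map_edges inr s0.
Proof.
rewrite /= mem_cat.
have arcsE b := stack_arcs i b (endpt D) (arcs D) s.
by case/orP=> ss; [exists false|exists true];
  apply: (states_transport _ ss) => p; rewrite -arcsE.
Qed.

Lemma planar_stack i s D : planar D -> planar (stack i s D).
Proof.
move=> plD s' /stack_states[b [s0 /plD[j J] eq_s']].
by exists (if b then cup_cap i j else j); have [] := layer_state J eq_s'.
Qed.

Lemma tangle_bracket_stack i s D : planar D ->
  tangle_bracket (stack i s D) = Bgen i (crossing_sgn s) *m tangle_bracket D.
Proof.
move=> plD; have arcsE b := stack_arcs i b (endpt D) (arcs D) s.
rewrite BgenE mulmxDl -!scalemxAl mul1mx.
have lin (A : 'M[laurent]_5) (x y : laurent) (u v : 'cV_5) :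
    A *m (x *: u + y *: v) = x *: (A *m u) + y *: (A *m v).
  by rewrite mulmxDr -!scalemxAr.
pose X b := map_edges (mark (endpt D)) (layer i b).
rewrite /tangle_bracket /=; congr (_ *: _ + _ *: _).
  rewrite -[RHS]mul1mx; apply: (resolve_transport (X := X false) (lin _)).
    by move=> p; rewrite -(arcsE false).
  move=> s0 s' /plD[j J] eq_s'; have [J' circ] := layer_state J eq_s'.
  rewrite -!/(tangle_value _ _) (tangle_valueE J) (tangle_valueE J').
  by rewrite circ addn0 mul1mx.
apply: (resolve_transport (X := X true) (lin _)).
  by move=> p; rewrite -(arcsE true).
move=> s0 s' /plD[j J] eq_s'; have [J' circ] := layer_state J eq_s'.
rewrite -!/(tangle_value _ _) (tangle_valueE J) (tangle_valueE J') circ exprD.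
rewrite -scalemxAr -scalerA; congr (_ *: _).
apply/colP => r; rewrite !mxE (bigD1 j) //= big1 => [|j' /negPf nj].
  by rewrite !mxE !eqxx mulr1 addr0 andbT mulr_natr.
by rewrite !mxE nj mulr0.
Qed.

(** * Plat presentations *)

(** The plat arcs are those of 0_3, whose index is 2 as indices start at 0. *)
Lemma plat_arcsE (V : Type) (e : 'I_6 -> V) :
  plat_arcs e = [seq (e p.1, e p.2) | p <- trivial_edges 2].
Proof.
pose plat_pairs : seq ('I_6 * 'I_6) :=
  [seq (inord p.1, inord p.2) | p <- [:: (0, 1); (2, 3); (4, 5)]%N].
have -> : trivial_edges 2 = plat_pairs; last by [].
have inj : injective (fun p : 'I_6 * 'I_6 => (p.1 : nat, p.2 : nat)).
  by case=> x y [x' y'] /= [/val_inj-> /val_inj->].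
by apply: (inj_map inj); rewrite /= !inordK.
Qed.

Lemma plat_bottom_state :
  joins_as 2 id (plat_arcs (id : 'I_6 -> 'I_6)) /\
  circles id (plat_arcs (id : 'I_6 -> 'I_6)) = 0%N.
Proof.
have arcsE : plat_arcs id = map_edges id (trivial_edges 2) ++ [::].
  by rewrite cats0 plat_arcsE.
have J : joins_as 2 id (plat_arcs (id : 'I_6 -> 'I_6)).
  by apply/joins_asP; rewrite arcsE; apply: labels_relabel labels_nil.
split=> //; apply: (@addIn (3 + 3)); rewrite addnA (circlesE J) arcsE.
have := n_comp_merges (trivial_edges 2) labels_nil.
by rewrite trivial_merges n_comp_nil card_ord.
Qed.

Lemma planar_q6 w : planar (q6 w).
Proof.
elim: w => [|l w IH].
  by move=> s; rewrite inE => /eqP->; exists 2; case: plat_bottom_state.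
by rewrite /=; elim: `|l.2|%N => //= n; apply: planar_stack.
Qed.

Lemma tangle_bracket_q6 w : (forall l, l \in w -> l.2 != 0) ->
  tangle_bracket (q6 w) = Bword w *m e3.
Proof.
elim: w => [_|l w IH nz0].
  have [J circ] := plat_bottom_state.
  rewrite /tangle_bracket /= -/(tangle_value _ _) (tangle_valueE J).
  rewrite circ scale1r /Bword big_nil mul1mx.
  by apply/colP => i; rewrite !mxE andbT.
have sgE : sgz l.2 = crossing_sgn (0 < l.2).
  have := nz0 l; rewrite inE eqxx /= => /(_ isT).
  by case: sgzP.
have -> : Bword (l :: w) *m e3 = Bpow l.1 l.2 *m (Bword w *m e3).
  by rewrite /Bword big_cons mulmxA.
rewrite -IH => [|l' wl']; last by apply: nz0; rewrite inE wl' orbT.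
rewrite /Bpow sgE /=; elim: `|l.2|%N => [|n IHn] /=.
  by rewrite expr0 mul1mx.
rewrite tangle_bracket_stack ?IHn ?exprS -?mulmxA //.
by elim: n {IHn} => /= [|n]; [exact: planar_q6|exact: planar_stack].
Qed.

(** The number of circles in the plat closure of 0_j. *)
Definition closure_loops (j : 'I_5) : nat := nth 0 [:: 1; 2; 3; 2; 2]%N j.

(** Each of the three arcs of the closure merges two components of 0_j or closes
    a circle. *)
Lemma closure_merges j :
  (merges (trivial_edges 2%R) (trivial_label j) + closure_loops j)%N = 3.
Proof. by apply/eqP; move: j; apply: all_ords; vm_compute. Qed.

(** A state with c circles which joins the endpoints as 0_j closes up to
    c + [closure_loops j] circles, and the bracket of a link counts one circle
    less. *)
Lemma link_bracket_closure D : planar D ->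
  link_bracket (plat_closure D)
    = \sum_j k ^+ (closure_loops j).-1 * tangle_bracket D j 0.
Proof.
move=> plD; pose F (v : 'cV[laurent]_5) : laurent^o :=
  \sum_j k ^+ (closure_loops j).-1 * v j 0.
have linF x y u v : F (x *: u + y *: v) = x *: F u + y *: F v.
  rewrite /F !scaler_sumr -big_split; apply: eq_bigr => j _.
  by rewrite !mxE mulrDr; congr (_ + _); rewrite mulrCA.
have crE : crossings D = [seq map_crossing id c | c <- crossings D].
  by rewrite -[LHS]map_id; apply: eq_map; case.
have idE (es : seq (point D * point D)) : map_edges id es = es.
  by rewrite -[RHS]map_id; apply: eq_map; case.
have arcsE : arcs (plat_closure D)
    = map_edges (endpt D) (trivial_edges 2) ++ map_edges id (arcs D).
  by rewrite idE -[map_edges _ _]plat_arcsE.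
rewrite /link_bracket arcsE [crossings (plat_closure D)]crE.
apply: (resolve_transport (X := map_edges (endpt D) (trivial_edges 2)) linF).
  by [].
move=> s s' /plD[j J] eq_s'.
rewrite -/(tangle_value _ _) (tangle_valueE J) /F (bigD1 j) //= big1;
  last first.
  by move=> i /negPf ij; rewrite !mxE ij mulr0 mulr0.
rewrite !mxE !eqxx mulr1 addr0 -exprD; congr (_ ^+ _).
have -> : circles (endpt (plat_closure D)) s' = n_comp (adjacent s') (point D).
  by apply: eq_n_comp_r => x; rewrite !inE; apply/forallP => -[].
have loops_gt0 : (0 < closure_loops j)%N by move: (j); apply: all_ords.
have -> : n_comp (adjacent s') (point D)
    = (circles (endpt D) s + closure_loops j)%N.
  apply: (@addIn (merges (trivial_edges 2%R) (trivial_label j))).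
  have eq_s : s' =i map_edges (endpt D) (trivial_edges 2) ++ s.
    by move=> p; rewrite eq_s' idE.
  rewrite (eq_n_comp_adjacent eq_s) n_comp_merges; last exact/joins_asP.
  by rewrite -(circlesE J) -addnA [(closure_loops _ + _)%N]addnC closure_merges.
by case: closure_loops loops_gt0 => // n _; rewrite addnS addnC.
Qed.

Theorem theorem3p1 (w : braid_word) (hw : forall l, l \in w -> l.2 != 0) :
  let T := q6 w in
  let K := plat_closure T in
  let f (i : nat) : laurent := (Bword w *m e3) (inord i.-1) 0 in
  tangle_bracket T = \sum_(i < 5) f i.+1 *: bracket0 i /\
  (is_knot K ->
     link_bracket K = f 1%N + k * (f 2%N + f 4%N + f 5%N) + k ^+ 2 * f 3%N /\
     (forall o : orientation, is_orientation K o ->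
        kauffman_poly K o =
          (- a ^ (-3)) ^ writhe K o
            * (f 1%N + k * (f 2%N + f 4%N + f 5%N) + k ^+ 2 * f 3%N))).
Proof.
move=> T K f.
have bracketT : tangle_bracket T = Bword w *m e3 := tangle_bracket_q6 hw.
have bracketK :
  link_bracket K = f 1%N + k * (f 2%N + f 4%N + f 5%N) + k ^+ 2 * f 3%N.
  rewrite (link_bracket_closure (@planar_q6 w)) bracketT.
  have -> : \sum_j k ^+ (closure_loops j).-1 * (Bword w *m e3) j 0
    = \sum_(j < 5) k ^+ (closure_loops j).-1 * f j.+1.
    by apply: eq_bigr => j _; rewrite /f /= inord_val.
  rewrite !big_ord_recl big_ord0 /=; ring.
split=> [|_].
  rewrite bracketT; apply/colP => i; rewrite summxE (bigD1 i) //= big1.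
    by rewrite !mxE !eqxx mulr1 addr0 /f inord_val mxE.
  by move=> j /negPf ij; rewrite !mxE eq_sym ij mulr0.
by split=> // o _; rewrite /kauffman_poly bracketK.
Qed.
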